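(* Let $L_U$ be an $h$-scattered $\mathbb{F}_q$-linear set of rank $\frac{rn}{h+1}$ in $\Omega=\mathrm{PG}(r-1,q^n)$ (where $q$ is a prime power and $r,n,h$ are positive integers with $h\le r-1$), and let $\mathcal{C}_{L_U}$ be the corresponding linear code over $\mathbb{F}_{q^n}$, having length $N=\theta_{\frac{rn}{h+1}-1}$ and dimension $k=r$. Then $\mathcal{C}_{L_U}$ has minimum distance $d=\theta_{\frac{rn}{h+1}-1}-\theta_{\frac{rn}{h+1}-n+h-1}$ and exactly $h+1$ weights, namely $w_i=\theta_{\frac{rn}{h+1}-1}-\theta_{\frac{rn}{h+1}-n+i-1}$ with $i=0,\ldots,h$. The weight enumerator of $\mathcal{C}_{L_U}$ is $$1+\sum_{i=0}^{h}A_{w_i}^H z^{w_i},$$ where $A_{w_i}^H=t_i$ and $$t_i=\frac{1}{q^n-1}{n \brack i}_q \sum_{j=0}^{h-i} (-1)^{j}{n-i \brack j}_q q^{\binom{j}{2}}\left(q^{\frac{rn(h-i-j+1)}{h+1}}-1\right).$$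
   Context: For an integer $m\ge -1$, $\theta_m=\frac{q^{m+1}-1}{q-1}$ (so $\theta_{-1}=0$). **Linear sets.** Let $V$ be an $r$-dimensional $\mathbb{F}_{q^n}$-vector space and $\Omega=\mathrm{PG}(V,\mathbb{F}_{q^n})=\mathrm{PG}(r-1,q^n)$. For a $k$-dimensional $\mathbb{F}_q$-subspace $U$ of $V$, the $\mathbb{F}_q$-linear set of rank $k$ defined by $U$ is the point set $L_U=\{\langle\mathbf u\rangle_{\mathbb{F}_{q^n}}:\mathbf u\in U\setminus\{\mathbf 0\}\}$. For a positive integer $h\le r-1$, $U$ (and $L_U$) is $h$-scattered if $\langle U\rangle_{\mathbb{F}_{q^n}}=V$ and $\dim_{\mathbb{F}_q}(U\cap H)\le h$ for every $h$-dimensional $\mathbb{F}_{q^n}$-subspace $H$ of $V$. **Codes from point sets.** Let $\mathcal{P}$ be a set of $N$ points of $\mathrm{PG}(r-1,q^n)$ not contained in any hyperplane (a projective system). The corresponding code $\mathcal{C}_{\mathcal{P}}$ is the $r$-dimensional $\mathbb{F}_{q^n}$-linear code of length $N$ having as generator matrix the $r\times N$ matrix whose columns are the coordinates of the points of $\mathcal{P}$ (different choices of the coordinates give codes equivalent by means of a diagonal matrix). Codes are considered with the Hamming metric: the weight of a codeword is the number of its nonzero components, $A_w^H$ denotes the number of codewords of weight $w$, and the weight enumerator of a code of length $N$ is $\sum_{w=0}^{N}A_w^Hz^w$. The $q$-binomial coefficient ${s\brack t}_q$ is $0$ if $s<0$ or $t<0$ or $t>s$, is $1$ if $t=0$ and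 $s\ge 0$, and is $\prod_{i=1}^t\frac{q^{s-i+1}-1}{q^i-1}$ otherwise.
   Formalization: The printed equality A_{w_i}^H = t_i is false (q=2, r=n=2, h=1 gives A_{w_0}^H = 6 but t_0 = 2), since t_i counts codewords up to nonzero scalars; it is replaced by A_{w_i}^H = (q^n-1) t_i, with t_i as printed. *)

(* Defs.v *)
From HB Require Import structures.
From mathcomp Require Import all_boot all_order all_algebra all_field.

Set Implicit Arguments.
Unset Strict Implicit.
Unset Printing Implicit Defensive.

Import Order.TTheory GRing.Theory Num.Theory.
Local Open Scope ring_scope.

(* Restriction of scalars: [baseVect V] is V regarded as a vector space over F,
   for L / F a finite extension. It plays for vector spaces the role that
   [baseFieldType] plays for field extensions, and the construction is the
   same. The F_q-subspaces of V are the terms of type {vspace baseVect V}, its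
   F_{q^n}-subspaces the terms of type {vspace V}. *)
Section BaseVect.

Variables (F : fieldType) (L : fieldExtType F) (V : vectType L).

Definition baseVect : predArgType := V.
Notation V0 := baseVect.

HB.instance Definition _ := GRing.Zmodule.on V0.

Definition baseVect_scale (a : F) (u : V0) : V0 := in_alg L a *: (u : V).
Local Infix "*F:" := baseVect_scale (at level 40).

Fact baseVect_scaleA a b u : a *F: (b *F: u) = (a * b) *F: u.
Proof. by rewrite [_ *F: _]scalerA -rmorphM. Qed.

Fact baseVect_scale1 u : 1 *F: u = u.
Proof. by rewrite /(1 *F: u) rmorph1 scale1r. Qed.

Fact baseVect_scaleDr a u v : a *F: (u + v) = a *F: u + a *F: v.
Proof. exact: (@scalerDr L V). Qed.

Fact baseVect_scaleDl v a b : (a + b) *F: v = a *F: v + b *F: v.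
Proof. by rewrite /baseVect_scale rmorphD; exact: (@scalerDl L V). Qed.

HB.instance Definition _ := GRing.Zmodule_isLmodule.Build F V0
  baseVect_scaleA baseVect_scale1 baseVect_scaleDr baseVect_scaleDl.

Lemma baseVect_scaleE a (u : V) : a *: (u : V0) = a%:A *: u.
Proof. by []. Qed.

Let n := \dim {:L}.
Let bF : n.-tuple L := vbasis {:L}.
Let coordF (x : L) := (coord_vbasis (memvf x)).

Fact baseVect_vectMixin : Lmodule_hasFinDim F V0.
Proof.
pose bV := vbasis {:V}; set m := \dim {:V} in bV *.
pose v2r (x : V0) := mxvec (\matrix_(i, j) coord bF j (coord bV i (x : V))).
have v2r_lin: linear v2r.
  move=> a x y; rewrite -linearP; congr mxvec; apply/matrixP=> i j.
  by rewrite !mxE (linearP (coord bV i)) /= mulr_algl linearP.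
pose r2v r : V0 :=
  \sum_(i < m) (\sum_(j < n) vec_mx r i j *: bF`_j) *: bV`_i.
have v2rK: cancel v2r r2v.
  move=> x; transitivity (\sum_(i < m) coord bV i (x : V) *: bV`_i : V).
    apply: eq_bigr => i _; rewrite mxvecK; congr (_ *: _ : V).
    by rewrite (coordF (coord bV i (x : V))); apply: eq_bigr => j _; rewrite mxE.
  by rewrite -(coord_vbasis (memvf (x : V))).
exists (m * n)%N, v2r => //; exists r2v => // r.
apply: (canLR vec_mxK); apply/matrixP=> i j; rewrite mxE.
by rewrite !coord_sum_free ?(basis_free (vbasisP _)).
Qed.

HB.instance Definition _ := baseVect_vectMixin.

Let FZEZ a x (v : V) : a *: ((x *: v : V) : V0) = (a *: x) *: v.
Proof. by rewrite [a *: _]scalerA -scalerAl mul1r. Qed.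

(* The L-subspace H of V, as an F-subspace. *)
Definition baseSubspace (H : {vspace V}) : {vspace V0} :=
  <<[seq (tnth bF ij.2 *: tnth (vbasis H) ij.1 : V0)
      | ij : 'I_(\dim H) * 'I_n]>>%VS.

Lemma mem_baseSubspace (H : {vspace V}) (v : V) :
  ((v : V0) \in baseSubspace H) = (v \in H).
Proof.
apply/idP/idP=> [/coord_span->|vH].
  apply: (@memv_suml L V) => k _; rewrite nth_image.
  case: (enum_val k) => i j /=.
  by rewrite FZEZ memvZ ?vbasis_mem ?mem_tnth.
rewrite {1}(coord_vbasis vH).
apply: (@memv_suml F V0) => i _; rewrite (coordF (coord _ i v)).
rewrite (@scaler_suml L V); apply: (@memv_suml F V0) => j _.
rewrite -FZEZ memvZ ?memv_span // -!tnth_nth.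
by apply/imageP; exists (i, j).
Qed.

(* The L-subspace of V generated by the F-subspace U. *)
Definition spanL (U : {vspace V0}) : {vspace V} := <<(vbasis U : seq V)>>%VS.

Lemma spanL_subvP (U : {vspace V0}) (H : {vspace V}) :
  reflect {in U, forall u, (u : V) \in H} (spanL U <= H)%VS.
Proof.
apply: (iffP span_subvP) => [sUH u uU | sUH u uU]; last first.
  by apply: sUH; apply: (@vbasis_mem F V0).
rewrite (coord_vbasis uU); apply: (@memv_suml L V) => i _.
rewrite (baseVect_scaleE _ ((vbasis U)`_i : V)).
by apply/memvZ/sUH; rewrite memt_nth.
Qed.

Definition h_scattered (h : nat) (U : {vspace V0}) : Prop :=
  spanL U = fullv /\
  forall H : {vspace V}, \dim H = h -> (\dim (U :&: baseSubspace H) <= h)%N.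

(* A point of PG(V) is a 1-dimensional subspace of V. *)
Definition linear_set (U : {vspace V0}) (P : {vspace V}) : Prop :=
  exists u : V, [/\ (u : V0) \in U, u != 0 & P = <[u]>%VS].

(* [p] lists coordinate vectors of the points of the point set [S], one
   vector for each point. *)
Definition point_listing (S : {vspace V} -> Prop) N (p : N.-tuple V) : Prop :=
  injective (fun j => <[tnth p j]>%VS) /\
  forall P, S P <-> exists j, P = <[tnth p j]>%VS.

(* Column j holds the coordinates of the j-th point in the basis e of V. *)
Definition generator_mx r (e : r.-tuple V) N (p : N.-tuple V) : 'M[L]_(r, N) :=
  \matrix_(i < r, j < N) coord e i (tnth p j).

End BaseVect.

Section Codes.

Variables (K : fieldType) (N : nat).
Implicit Types (c : 'rV[K]_N) (C : {vspace 'rV[K]_N}).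

Definition generated_code r (G : 'M[K]_(r, N)) : {vspace 'rV[K]_N} :=
  <<[seq row i G | i : 'I_r]>>%VS.

Definition hweight c : nat := #|[set j | c ord0 j != 0]|.

Definition min_distance C (d : nat) : Prop :=
  (exists c c', [/\ c \in C, c' \in C, c != c' & hweight (c - c') = d]) /\
  (forall c c', c \in C -> c' \in C -> c != c' -> (d <= hweight (c - c'))%N).

End Codes.

(* [finvect_type L] is L with its structure of finite field. *)
Section Weights.

Variables (F : finFieldType) (L : fieldExtType F) (N : nat).
Implicit Type C : {vspace 'rV[L]_N}.

Definition codewords C : {set 'rV[finvect_type L]_N} :=
  [set c : 'rV[finvect_type L]_N | (c : 'rV[L]_N) \in C].

Definition weight_distr C (w : nat) : nat :=
  #|[set c in codewords C | hweight c == w]|.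

Definition weights C : seq nat :=
  undup [seq hweight c | c in codewords C :\ 0].

Definition weight_enumerator C : {poly int} :=
  \sum_(w < N.+1) (weight_distr C w)%:R *: 'X^w.

End Weights.

(* Used for m >= -1 only, where the division is exact. *)
Definition theta (q : nat) (m : int) : nat := (q ^ `|m + 1| - 1) %/ (q - 1).

Definition qbinom (q : nat) (s t : int) : rat :=
  if [|| s < 0, t < 0 | t > s] then 0
  else \prod_(1 <= i < `|t|.+1)
         ((q%:R ^ (s - i%:Z + 1) - 1) / (q%:R ^+ i - 1)).

(* Below, k is the rank rn/(h+1). Spanning V forces k >= r, i.e. n >= h + 1, so
   that the natural-number subtraction is never truncated for i <= h; and
   k >= n, so that the arguments of theta are at least -1. *)
Definition code_weight (q k n i : nat) : nat :=
  theta q (k%:Z - 1) - theta q (k%:Z - n%:Z + i%:Z - 1).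

(* This number counts the hyperplanes meeting the linear set in a given number
   of points, that is, the codewords of a given weight up to multiplication by
   a nonzero scalar: the codewords themselves are q^n - 1 times as many. The
   exponent r n (h-i-j+1) / (h+1) is an integer when h + 1 divides r n. *)
Definition tcoef (q r n h i : nat) : rat :=
  1 / (q%:R ^+ n - 1) * qbinom q n%:Z i%:Z *
  \sum_(j < (h - i).+1)
     (-1) ^+ j * qbinom q (n%:Z - i%:Z) j%:Z * q%:R ^+ 'C(j, 2) *
     (q%:R ^+ ((r * n * (h - i - j + 1)) %/ h.+1) - 1).

(* Main.v *)
From HB Require Import structures.
Require Import Defs.
From mathcomp Require Import all_boot all_order all_algebra all_field.
From mathcomp Require Import zify ring lra.

Set Implicit Arguments.
Unset Strict Implicit.
Unset Printing Implicit Defensive.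

Import Order.TTheory GRing.Theory Num.Theory.
Local Open Scope ring_scope.

(** Write k for the rank of U. A codeword is the list of values at the points
of a linear functional f on V, and f also restricts to an F_q-linear map from
U to L = F_(q^n). Since U is 1-scattered, each point of the linear set carries
q - 1 nonzero vectors of U, so the weight of the codeword is determined by the
dimension of the kernel of f on U, or equivalently by the dimension y of the
cokernel of f : U -> L, where dim ker = k - n + y. The theorem thus describes
the distribution of y; in particular, the maps f form a maximum rank distance
code.

The moments of the kernel dimension come from a double count. An h-scattered U
has the property that at most h + 1 vectors of U independent over F_q are
independent over L ([dim_spanL]), so for j <= h + 1 exactly q^(n(r-j))
functionals vanish on j given independent vectors of U ([vanishing_moment]).
These are the moments that a uniformly random k x n matrix over F_q would
have. For a random matrix, kernel and cokernel play symmetric roles, and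
[dual_moments] carries this symmetry over: it turns the first h + 1 moments of
the kernel into the first h + 1 moments of the cokernel ([coker_moment]).

When k(h + 1) = rn the moment of order h + 1 of the cokernel equals the
contribution of f = 0 alone. It is a sum of the nonnegative numbers of
independent (h + 1)-tuples in the cokernels, so y <= h for every nonzero f
([coker_dim_leq]). The moments of order at most h then determine the number of
f with y = i, by q-binomial inversion ([count_from_moments]), which gives the
formula for t_i. Finally t_i is an alternating sum with strictly decreasing
terms, since n <= k ([tcoef_gt0]); so each of the h + 1 weights occurs. *)

(** * q-analogues of falling factorials and their moments *)

Section QFactorial.

Variables (R : realFieldType) (q : R).

(** For X = q^x, the number of j-tuples of linearly independent vectors in an
x-dimensional space over F_q. *)
Definition qfall (X : R) (j : nat) : R := \prod_(l < j) (X - q ^+ l).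

(** The q-Pochhammer symbol (q; q)_j up to the sign (-1)^j. *)
Definition qpoch (j : nat) : R := \prod_(l < j) (q ^+ l.+1 - 1).

Lemma qfall0 X : qfall X 0 = 1. Proof. by rewrite /qfall big_ord0. Qed.

Lemma qfallS X j : qfall X j.+1 = qfall X j * (X - q ^+ j).
Proof. by rewrite /qfall big_ord_recr. Qed.

Lemma qpochS j : qpoch j.+1 = qpoch j * (q ^+ j.+1 - 1).
Proof. by rewrite /qpoch big_ord_recr. Qed.

Lemma qfall_small m j : (m < j)%N -> qfall (q ^+ m) j = 0.
Proof. by move=> lt_mj; rewrite /qfall (bigD1 (Ordinal lt_mj)) //= subrr mul0r. Qed.

(** An independent tuple of length i + j consists of its first i vectors and of
j vectors that are independent modulo their span W; each vector modulo W has
q^i lifts. *)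
Lemma qfall_addr i j m :
  qfall (q ^+ (i + m)) (i + j) =
    qfall (q ^+ (i + m)) i * q ^+ (i * j) * qfall (q ^+ m) j.
Proof.
elim: j => [|j IHj]; first by rewrite addn0 muln0 qfall0 !mulr1.
by rewrite addnS !qfallS IHj mulnS !exprD; ring.
Qed.

Lemma qfall_diag j : qfall (q ^+ j) j = q ^+ 'C(j, 2) * qpoch j.
Proof.
elim: j => [|j IHj]; first by rewrite qfall0 /qpoch big_ord0 mulr1.
have := qfall_addr 1 j j; rewrite add1n IHj => ->.
rewrite qfallS qfall0 qpochS binS bin1 mul1n exprD; ring.
Qed.

(** Let K = q^k and A = q^n. If X = q^x, where x is the kernel dimension of a
map from F_q^k to F_q^n, then X * A / K = q^y, where y is the cokernel dimension.
For a uniformly random map, the mixed moment counts independent i-tuples in the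
kernel against independent j-tuples in the annihilator of the image; both
conditions together impose n i + k j - i j independent linear equations on the
map, whence the right-hand side. The moments of the kernel alone suffice for
this formula: the last factor of [qfall (X * A / K) j.+1] is an affine function
of X - q^i, which gives an induction on j. *)
Lemma dual_moments (I : finType) (X : I -> R) (K A M : R) (J : nat) :
    K != 0 -> A != 0 ->
    (forall i, (i <= J)%N -> \sum_a qfall (X a) i = M * qfall K i / A ^+ i) ->
  forall j i, (i + j <= J)%N ->
    \sum_a qfall (X a) i * qfall (X a * A / K) j =
      M * qfall K i * qfall A j / (A ^+ i * K ^+ j) * q ^+ (i * j).
Proof.
move=> K0 A0 mom; elim=> [|j IHj] i le_ijJ.
  rewrite muln0 qfall0 !mulr1 -mom; last by rewrite -(addn0 i).
  by apply: eq_bigr => a _; rewrite qfall0 mulr1.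
(* X A / K - q^j = (A / K) (X - q^i) + ((A / K) q^i - q^j) *)
transitivity
  (A / K * \sum_a qfall (X a) i.+1 * qfall (X a * A / K) j
   + (A / K * q ^+ i - q ^+ j) * \sum_a qfall (X a) i * qfall (X a * A / K) j).
  rewrite !mulr_sumr -big_split; apply: eq_bigr => a _ /=.
  by rewrite !qfallS; field.
rewrite !IHj; [|lia|lia].
rewrite !qfallS mulnS mulSn !exprD !exprS; field.
by rewrite K0 A0 !expf_neq0.
Qed.

Hypothesis q_gt1 : 1 < q.

Lemma q_gt0 : 0 < q. Proof. exact: lt_trans q_gt1. Qed.

Lemma qX_gt0 m : 0 < q ^+ m. Proof. by rewrite exprn_gt0 ?q_gt0. Qed.

Lemma qX_neq0 m : q ^+ m != 0. Proof. by rewrite gt_eqF ?qX_gt0. Qed.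

Lemma qpoch_gt0 j : 0 < qpoch j.
Proof. by apply: prodr_gt0 => l _; rewrite subr_gt0 exprn_egt1. Qed.

Lemma qpoch_neq0 j : qpoch j != 0. Proof. by rewrite gt_eqF ?qpoch_gt0. Qed.

Lemma qfall_gt0 m j : (j <= m)%N -> 0 < qfall (q ^+ m) j.
Proof.
move=> le_jm; apply: prodr_gt0 => l _.
by rewrite subr_gt0 ltr_eXn2l // (leq_trans (ltn_ord l)).
Qed.

Lemma qfall_ge0 m j : 0 <= qfall (q ^+ m) j.
Proof.
have [/qfall_gt0/ltW // | lt_mj] := leqP j m.
by rewrite qfall_small.
Qed.

(** The partial sums of the q-binomial theorem, seen as polynomials in Z, factor
completely: the sum up to s vanishes at q, ..., q^s and is 1 at Z = 1. *)
Lemma alternating_qfall Z s :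
  \sum_(j < s.+1) (-1) ^+ j * qfall Z j / qpoch j =
    (-1) ^+ s * (\prod_(l < s) (Z - q ^+ l.+1)) / qpoch s.
Proof.
elim: s => [|s IHs]; first by rewrite big_ord_recr !big_ord0 qfall0 /= add0r.
rewrite big_ord_recr /= IHs qpochS big_ord_recr /=.
rewrite [qfall Z s.+1]/qfall big_ord_recl expr0 /=.
under [in X in _ + X]eq_bigr do rewrite /bump /= add1n.
have : q ^+ s.+1 - 1 != 0 by rewrite subr_eq0 gt_eqF // exprn_egt1.
rewrite [(-1) ^+ s.+1]exprS; move: (q ^+ s.+1) => x x1; field.
by rewrite x1 qpoch_neq0.
Qed.

Lemma alternating_qfall_exp m s : (m <= s)%N ->
  \sum_(j < s.+1) (-1) ^+ j * qfall (q ^+ m) j / qpoch j = (m == 0)%:R.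
Proof.
move=> le_ms; rewrite alternating_qfall; case: m le_ms => [|m] le_ms /=.
  rewrite expr0 -[LHS]mulrA mulrCA.
  have ->: (-1) ^+ s = \prod_(l < s) (-1 : R).
    by rewrite prodr_const card_ord.
  rewrite mulrA -big_split /=.
  under eq_bigr do rewrite mulrN1 opprB.
  by rewrite mulfV ?qpoch_neq0.
by rewrite (bigD1 (Ordinal le_ms)) //= subrr mul0r mulr0 mul0r.
Qed.

(** q-binomial inversion: the combination of the moments of order i, ..., h on
the right-hand side weighs an index a by 1 if y a = i and by 0 otherwise. *)
Lemma count_from_moments (I : finType) (P : pred I) (y : I -> nat) h (B : nat -> R) :
    (forall a, P a -> (y a <= h)%N) ->
    (forall j, (j <= h)%N -> \sum_(a | P a) qfall (q ^+ y a) j = B j) ->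
  forall i, (i <= h)%N ->
    #|[set a | P a & y a == i]|%:R =
      \sum_(j < (h - i).+1)
         (-1) ^+ j * B (i + j)%N / (qfall (q ^+ i) i * q ^+ (i * j) * qpoch j).
Proof.
move=> le_yh mom i le_ih.
transitivity (\sum_(a | P a) (y a == i)%:R : R).
  rewrite -sum1_card natr_sum big_mkcond [RHS]big_mkcond /=.
  by apply: eq_bigr => a _; rewrite inE; case: (P a); case: (y a == i).
transitivity (\sum_(a | P a) \sum_(j < (h - i).+1)
   (-1) ^+ j * qfall (q ^+ y a) (i + j)
     / (qfall (q ^+ i) i * q ^+ (i * j) * qpoch j)); last first.
  rewrite exchange_big; apply: eq_bigr => j _.
  by rewrite -mulr_suml -mulr_sumr mom //; have := ltn_ord j; lia.
apply: eq_bigr => a Pa; have [lt_yi | le_iy] := ltnP (y a) i.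
  rewrite big1 ?ltn_eqF // => j _.
  by rewrite qfall_small ?mulr0 ?mul0r // ltn_addr.
have [m def_y] : exists m, y a = (i + m)%N by exists (y a - i)%N; lia.
have le_mh : (m <= h - i)%N by have := le_yh a Pa; lia.
transitivity (qfall (q ^+ (i + m)) i / qfall (q ^+ i) i * (m == 0)%:R).
  rewrite def_y -[X in _ == X]addn0 eqn_add2l.
  case: eqP => [->|_]; last by rewrite mulr0.
  by rewrite addn0 divff ?mulr1 // gt_eqF // qfall_gt0.
rewrite -(alternating_qfall_exp le_mh) mulr_sumr def_y; apply: eq_bigr => j _.
rewrite qfall_addr; field.
by rewrite qX_neq0 qpoch_neq0 gt_eqF // qfall_gt0.
Qed.

Lemma alternating_sum_bounds (T : nat -> R) s :
    (forall j, (j <= s)%N -> 0 < T j) -> (forall j, (j < s)%N -> T j.+1 < T j) ->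
  0 < \sum_(j < s.+1) (-1) ^+ j * T j <= T 0.
Proof.
elim: s T => [|s IHs] T Tpos Tdecr.
  by rewrite big_ord_recr big_ord0 /= add0r mul1r Tpos /=.
rewrite big_ord_recl mul1r /=.
under eq_bigr do rewrite /bump /= add1n exprS mulN1r mulNr.
rewrite sumrN subr_gt0 gerBl.
have/andP[S_gt0 leST] := IHs (T \o succn) (fun j => Tpos j.+1) (fun j => Tdecr j.+1).
by rewrite ltW ?andbT //; apply: le_lt_trans leST _; apply: Tdecr.
Qed.

End QFactorial.

(** * The numbers t_i *)

Lemma qfall_prod (R : realFieldType) (q : R) s t : (t <= s)%N ->
  qfall q (q ^+ s) t = q ^+ 'C(t, 2) * \prod_(l < t) (q ^+ (s - l) - 1).
Proof.
elim: t => [|t IHt] le_ts; first by rewrite qfall0 big_ord0 mulr1.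
rewrite qfallS IHt 1?ltnW // big_ord_recr /= binS bin1 exprD.
by rewrite -{2}(subnK (ltnW le_ts)) exprD; ring.
Qed.

Lemma qbinomE (q s t : nat) : (0 < q)%N -> (t <= s)%N ->
  qbinom q s t = qfall q%:R (q%:R ^+ s) t / (q%:R ^+ 'C(t, 2) * qpoch q%:R t) :> rat.
Proof.
move=> q_gt0 le_ts; rewrite /qbinom ifF; last by apply/negbTE; lia.
have q0 : (q%:R : rat) != 0 by rewrite pnatr_eq0 -lt0n.
rewrite qfall_prod // -mulf_div divff ?mul1r ?expf_neq0 //.
rewrite absz_nat big_add1 /= big_mkord big_split prodfV /=; congr (_ / _).
apply: eq_bigr => l _; congr (_ - 1).
have lt_l := ltn_ord l; rewrite exprnP; congr (_ ^ _); lia.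
Qed.

(** The value that [count_from_moments] gives when the moment of order l is
[qfall (q^n) l * (q^(k(h+1-l)) - 1)] with k = rn/(h+1). *)
Lemma tcoefE (q r n h i : nat) : (1 < q)%N -> (h < n)%N -> (i <= h)%N ->
    (h.+1 %| r * n)%N ->
  (q%:R ^+ n - 1) * tcoef q r n h i =
  \sum_(j < (h - i).+1) (-1) ^+ j *
    (qfall q%:R (q%:R ^+ n) (i + j) *
      (q%:R ^+ ((r * n) %/ h.+1 * (h.+1 - (i + j))) - 1)) /
    (qfall q%:R (q%:R ^+ i) i * q%:R ^+ (i * j) * qpoch q%:R j) :> rat.
Proof.
move=> q_gt1 lt_hn le_ih /dvdnP[k rn_eq].
have Q_gt1 : 1 < q%:R :> rat by rewrite ltr1n.
have Qn1 : (q%:R ^+ n - 1 : rat) != 0.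
  by rewrite subr_eq0 gt_eqF // exprn_egt1 //; lia.
rewrite /tcoef rn_eq mulnK // div1r -mulrA mulVKf // mulr_sumr.
apply: eq_bigr => j _; have lt_j := ltn_ord j.
have -> : n%:Z - i%:Z = (n - i)%:Z by lia.
rewrite !qbinomE; try lia.
have -> : (k * h.+1 * (h - i - j + 1) %/ h.+1 = k * (h.+1 - (i + j)))%N.
  by rewrite mulnAC mulnK //; congr (_ * _)%N; lia.
have := qfall_addr (q%:R : rat) i j (n - i); rewrite subnKC => [->|]; last by lia.
rewrite qfall_diag.
have P0 := qpoch_neq0 Q_gt1; have X0 := qX_neq0 Q_gt1.
by field; rewrite !P0 !X0.
Qed.

(** The terms of the alternating sum decrease: the quotient of two consecutive
ones is less than q^(n-i) / q^k, and n <= k because h < r. *)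
Lemma tcoef_gt0 (q r n h i : nat) : (1 < q)%N -> (h < n)%N -> (h < r)%N ->
    (i <= h)%N -> (h.+1 %| r * n)%N ->
  0 < tcoef q r n h i.
Proof.
move=> q_gt1 lt_hn lt_hr le_ih dvd_rn.
have Q_gt1 : 1 < q%:R :> rat by rewrite ltr1n.
have Qn1 : 0 < (q%:R ^+ n - 1 : rat) by rewrite subr_gt0 exprn_egt1 //; lia.
rewrite -(pmulr_rgt0 _ Qn1) tcoefE //.
have [k rn_eq] := dvdnP dvd_rn; rewrite rn_eq mulnK //.
have le_nk : (n <= k)%N.
  by rewrite -(leq_pmul2r (ltn0Sn h)) -rn_eq mulnC leq_mul2r lt_hr orbT.
set T : nat -> rat := fun j => 
 qfall q%:R (q%:R ^+ n) i / qfall q%:R (q%:R ^+ i) i *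
   (qfall q%:R (q%:R ^+ (n - i)) j / qpoch q%:R j) * 
   (q%:R ^+ (k * (h.+1 - (i + j))) - 1).
have P0 := qpoch_neq0 Q_gt1; have X0 := qX_neq0 Q_gt1.
have F0 : qfall q%:R (q%:R ^+ i) i != 0 :> rat by rewrite gt_eqF // qfall_gt0.
rewrite (_ : \sum_(j < _) _ = \sum_(j < (h - i).+1) (-1) ^+ j * T j); last first.
  apply: eq_bigr => j _; rewrite /T.
  have := qfall_addr (q%:R : rat) i j (n - i); rewrite subnKC => [->|]; last by lia.
  field.
  by rewrite P0 X0 F0.
have k_gt0 : (0 < k)%N by lia.
have c_gt0 j : (j <= h - i)%N ->
    0 < qfall q%:R (q%:R ^+ n) i / qfall q%:R (q%:R ^+ i) i *
        (qfall q%:R (q%:R ^+ (n - i)) j / qpoch q%:R j) :> rat.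
  move=> le_j; rewrite mulr_gt0 // divr_gt0 ?qpoch_gt0 ?qfall_gt0 //; lia.
have T_gt0 j : (j <= h - i)%N -> 0 < T j.
  by move=> le_j; rewrite mulr_gt0 ?c_gt0 // subr_gt0 exprn_egt1 // muln_eq0; lia.
have T_decr j : (j < h - i)%N -> T j.+1 < T j.
  move=> lt_j; rewrite {1}/T qfallS qpochS -mulf_div /T.
  rewrite [X in X * _ < _]mulrA -[X in X < _]mulrA.
  rewrite ltr_pM2l ?c_gt0 1?ltnW //.
  set x := q%:R ^+ (k * (h.+1 - (i + j.+1))).
  have -> : q%:R ^+ (k * (h.+1 - (i + j))) = q%:R ^+ k * x.
    by rewrite -exprD -mulnS; congr (_ ^+ (_ * _)); lia.
  have x_gt1 : 1 < x by rewrite exprn_egt1 // muln_eq0; lia.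
  set y := q%:R ^+ j.+1 - 1.
  (* Here q is used as an integer: q >= 2. *)
  have y_ge1 : 1 <= y.
    rewrite lerBrDr -(natrD _ 1 1) -natrX ler_nat.
    by rewrite (leq_trans q_gt1) // -{1}[q]expn1 leq_exp2l.
  have K_ge1 : 1 < q%:R ^+ k :> rat by rewrite exprn_egt1 //; lia.
  have le_K : q%:R ^+ (n - i) - q%:R ^+ j <= q%:R ^+ k :> rat.
    have : q%:R ^+ (n - i) <= q%:R ^+ k :> rat by rewrite ler_eXn2l //; lia.
    by have := qX_gt0 Q_gt1 j; lra.
  have {}le_K : (q%:R ^+ (n - i) - q%:R ^+ j) / y <= q%:R ^+ k.
    rewrite ler_pdivrMr ?(lt_le_trans ltr01) // (le_trans le_K) //.
    by rewrite ler_peMr // ltW // qX_gt0.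
  have x1 : 0 < x - 1 by rewrite subr_gt0.
  apply: (@le_lt_trans _ _ (q%:R ^+ k * (x - 1))); first by rewrite ler_pM2r.
  by rewrite mulrBr mulr1; lra.
by have/andP[] := alternating_sum_bounds T_gt0 T_decr.
Qed.

(** * Scattered subspaces meet small subspaces in small dimension *)

Section Scattered.

Variables (F : fieldType) (L : fieldExtType F) (V : vectType L).
Local Notation V0 := (baseVect V).
Implicit Types (U T : {vspace V0}) (H : {vspace V}).

Lemma subv_baseSubspace T H : (T <= baseSubspace H)%VS = (spanL T <= H)%VS.
Proof.
apply/subvP/spanL_subvP => sTH u Tu; first by rewrite -mem_baseSubspace sTH.
by rewrite mem_baseSubspace sTH.
Qed.

Lemma dimv_add_vline (K : fieldType) (vT : vectType K) (W : {vspace vT}) u :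
  u \notin W -> \dim (W + <[u]>) = (\dim W).+1.
Proof.
move=> nWu; rewrite dimv_disjoint_sum ?dim_vline.
  by rewrite (_ : u != 0) ?addn1 //; apply: contraNneq nWu => ->; apply: mem0v.
apply/eqP; rewrite -subv0; apply/subvP => v; rewrite memv_cap => /andP[Wv].
case/vlineP => c def_v; move: Wv; rewrite def_v.
have [-> | c0] := eqVneq c 0; first by rewrite scale0r !mem0v.
by rewrite rpredZeq (negPf c0) (negPf nWu).
Qed.

(** Subspaces of dimension less than h inherit the bound from those of dimension
h: as U spans V, some vector of U lies outside H, and adjoining it to H raises
the dimension of H by 1 and that of its intersection with U by at least 1. *)
Lemma h_scattered_cap h U H : (h < \dim {:V})%N -> h_scattered h U ->
  (\dim H <= h)%N -> (\dim (U :&: baseSubspace H) <= \dim H)%N.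
Proof.
move=> lt_h [spanU scatU]; move def_d: (h - \dim H)%N => d.
elim: d H def_d => [|d IHd] H def_d le_Hh.
  have dimH : \dim H = h by lia.
  by have := scatU H dimH; rewrite dimH.
have /subvPn[u Uu nHu] : ~~ (U <= baseSubspace H)%VS.
  apply/negP; rewrite subv_baseSubspace spanU => /dimvS; lia.
have dimH' : \dim (H + <[u : V]>) = (\dim H).+1.
  by apply: dimv_add_vline; rewrite -mem_baseSubspace.
rewrite -ltnS -dimH' -(dimv_add_vline (u := u)); last by rewrite memv_cap (negPf nHu) andbF.
apply: leq_trans (IHd (H + <[u : V]>)%VS _ _); try lia.
apply/dimvS; rewrite subv_add subv_cap capvSl /= -memvE memv_cap Uu /=.
apply/andP; split; last by rewrite mem_baseSubspace (subvP (addvSr _ _)) ?memv_line.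
apply/subvP => v; rewrite memv_cap !mem_baseSubspace => /andP[_].
exact/subvP/addvSl.
Qed.

Lemma dim_spanL_leq T : (\dim (spanL T) <= \dim T)%N.
Proof. by apply: leq_trans (dim_span _) _; rewrite size_tuple. Qed.

(** Vectors of U independent over F stay independent over L, as long as there
are at most h + 1 of them: otherwise their span over L has dimension at most h
and meets U in too large a subspace. *)
Lemma dim_spanL h U T : (h < \dim {:V})%N -> h_scattered h U ->
  (T <= U)%VS -> (\dim T <= h.+1)%N -> \dim (spanL T) = \dim T.
Proof.
move=> lt_h scatU sTU le_Th; apply/eqP; rewrite eqn_leq dim_spanL_leq /=.
have [le_h | lt_hT] := leqP (\dim (spanL T)) h; last exact: leq_trans lt_hT.
apply: leq_trans (h_scattered_cap lt_h scatU le_h).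
by apply/dimvS; rewrite subv_cap sTU subv_baseSubspace subvv.
Qed.

End Scattered.

Section Functionals.

Variables (F : fieldType) (L : fieldExtType F) (V : vectType L).
Variables (r : nat) (e : r.-tuple V).
Local Notation V0 := (baseVect V).
Implicit Types (a : 'rV[L]_r) (v : V).

Definition functional a v : L := \sum_(i < r) a 0 i * coord e i v.

Fact functional_is_linear a : linear (functional a : V -> L^o).
Proof.
move=> x u v; rewrite /functional scaler_sumr -big_split; apply: eq_bigr => i _.
by rewrite linearP /= mulrDr mulrCA.
Qed.
HB.instance Definition _ a :=
  GRing.isLinear.Build L V L^o _ (functional a) (functional_is_linear a).

Lemma functionalZ a x v : functional a (x *: v) = x * functional a v.
Proof.
rewrite /functional mulr_sumr; apply: eq_bigr => i _.
by rewrite linearZ /= mulrCA.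
Qed.

Fact functional_base_is_linear a : linear (functional a : V0 -> L).
Proof.
move=> x u v; have:= functional_is_linear a x%:A u v => /= ->.
by rewrite -[RHS]/(x *: _ + _) -[in RHS]mulr_algl.
Qed.
(** The functional as a map of vector spaces over F, so that its kernel can be
intersected with F-subspaces. *)
Definition functional_base a : V0 -> L := functional a.
HB.instance Definition _ a :=
  GRing.isLinear.Build F V0 L _ (functional_base a) (functional_base_is_linear a).

Definition zeros (U : {vspace V0}) a : {vspace V0} :=
  (U :&: lker (linfun (functional_base a)))%VS.

Lemma mem_zeros U a (u : V0) : (u \in zeros U a) = (u \in U) && (functional a u == 0).
Proof. by rewrite memv_cap memv_ker lfunE. Qed.

Lemma zeros0 U : zeros U 0 = U.
Proof.
apply/vspaceP => u; rewrite mem_zeros /functional big1 ?eqxx ?andbT // => i _.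
by rewrite mxE mul0r.
Qed.

Lemma codim_zeros_leq U a :
  (\dim U <= \dim (zeros U a) + \dim {:L})%N.
Proof.
rewrite -(limg_ker_dim (linfun (functional_base a)) U) leq_add2l.
exact/dimvS/subvf.
Qed.

Lemma sub_zeros U a (T : {vspace V0}) : (T <= zeros U a)%VS =
  (T <= U)%VS && (spanL T <= lker (linfun (functional a : V -> L^o)))%VS.
Proof.
rewrite subv_cap; congr andb.
apply/subvP/spanL_subvP => T0 u Tu.
  by have:= T0 u Tu; rewrite !memv_ker !lfunE.
by have:= T0 u Tu; rewrite !memv_ker !lfunE.
Qed.

Hypothesis basis_e : basis_of fullv e.

Lemma functionalE (f : 'Hom(V, L^o)) v :
  functional (\row_i f e`_i) v = f v.
Proof.
rewrite {2}(coord_basis basis_e (memvf v)) linear_sum.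
by apply: eq_bigr => i _; rewrite linearZ mxE mulrC.
Qed.

Definition restrict_functional d (b : d.-tuple V) a : 'rV[L]_d :=
  \row_j functional a b`_j.

Fact restrict_functional_is_linear d (b : d.-tuple V) :
  linear (restrict_functional b).
Proof.
move=> x a a'; apply/rowP => j; rewrite !mxE mulr_sumr -big_split.
by apply: eq_bigr => i _; rewrite !mxE mulrDl mulrA.
Qed.
HB.instance Definition _ d (b : d.-tuple V) :=
  GRing.isLinear.Build L 'rV[L]_r 'rV[L]_d _ (restrict_functional b)
    (restrict_functional_is_linear b).

(** The coordinate forms of a free family are defined on the whole space, so a
functional with prescribed values on the family is a combination of them. *)
Lemma restrict_functional_surj d (b : d.-tuple V) : free b ->
  limg (linfun (restrict_functional b)) = fullv.
Proof.
move=> free_b; apply/eqP; rewrite eqEsubv subvf; apply/subvP => c _.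
have flin : linear (fun v => \sum_j c 0 j * coord b j v : L^o).
  move=> x u v; rewrite scaler_sumr -big_split; apply: eq_bigr => j _ /=.
  by rewrite linearP /= mulrDr mulrCA.
pose fL := GRing.isLinear.Build L V L^o _ _ flin.
pose f : {linear V -> L^o} := HB.pack (fun v => \sum_j c 0 j * coord b j v : L^o) fL.
have -> : c = linfun (restrict_functional b) (\row_i linfun f e`_i).
  apply/rowP => j; rewrite lfunE mxE functionalE lfunE /= (bigD1 j) //=.
  rewrite coord_free // eqxx mulr1 big1 ?addr0 // => l ne_lj.
  by rewrite coord_free // eq_sym (negPf ne_lj) mulr0.
exact/memv_img/memvf.
Qed.

Lemma dim_annihilator (H : {vspace V}) :
  \dim (lker (linfun (restrict_functional (vbasis H)))) = (r - \dim H)%N.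
Proof.
have := limg_ker_dim (linfun (restrict_functional (vbasis H))) fullv.
rewrite capfv restrict_functional_surj ?(basis_free (vbasisP H)) //.
by rewrite !dimvf /dim /= !mul1n => /(canRL (addnK _)).
Qed.

Lemma mem_annihilator (H : {vspace V}) a :
  (a \in lker (linfun (restrict_functional (vbasis H)))) =
    (H <= lker (linfun (functional a : V -> L^o)))%VS.
Proof.
rewrite memv_ker lfunE; apply/eqP/subvP => [a0 v Hv | a0 /=].
  rewrite memv_ker lfunE /= (coord_vbasis Hv) linear_sum big1 // => j _.
  by rewrite linearZ; have /rowP/(_ j) := a0; rewrite !mxE /= => ->; rewrite scaler0.
apply/rowP => j; rewrite !mxE; apply/eqP.
have /a0 : (vbasis H)`_j \in H by rewrite vbasis_mem ?memt_nth.
by rewrite memv_ker lfunE.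
Qed.

End Functionals.

(** * Functionals vanishing on subspaces of a scattered subspace *)

Section Moments.

Variables (F : finFieldType) (L : fieldExtType F) (V : vectType L).
Local Notation V0 := (baseVect V).
Local Notation fL := (finvect_type L).
Local Notation q := (#|F|%:R : rat).
Local Notation n := (\dim {:L}).
Local Notation r := (\dim {:V}).

Lemma card_finvect_ext : #|fL| = (#|F| ^ n)%N.
Proof. transitivity #|[set u : fL | u \in {:L}%VS]|; last first.
  by rewrite cardsE; apply: (@card_vspace F fL).
by rewrite -cardsT; apply: eq_card => u; rewrite !inE memvf. Qed.

Lemma card_subspace (W : {vspace V0}) :
  #|[set u : finvect_type V0 | (u : V0) \in W]| = (#|F| ^ \dim W)%N.
Proof. by rewrite cardsE; apply: (@card_vspace F (finvect_type V0)). Qed.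

Variables (e : r.-tuple V) (basis_e : basis_of fullv e).
Variables (h : nat) (U : {vspace V0}).
Hypotheses (lt_hr : (h < r)%N) (scatU : h_scattered h U).

(** A functional vanishes on T if and only if it vanishes on the span of T over
L, whose dimension over L is that of T over F. *)
Lemma card_vanishing (T : {vspace V0}) : (T <= U)%VS -> (\dim T <= h.+1)%N ->
  #|[set a : 'rV[fL]_r | (T <= zeros e U a)%VS]| = (#|F| ^ (n * (r - \dim T)))%N.
Proof.
move=> sTU le_Th.
rewrite expnM -card_finvect_ext -(dim_spanL lt_hr scatU sTU le_Th).
rewrite -(dim_annihilator basis_e (spanL T)).
transitivity #|[set a : 'rV[fL]_r |
    a \in lker (linfun (restrict_functional e (vbasis (spanL T))))]|.
  by apply: eq_card => a; rewrite !inE mem_annihilator sub_zeros sTU.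
by rewrite cardsE; apply: (@card_vspace fL 'rV[fL]_r).
Qed.

(** Double count of the pairs of a functional a vanishing on T and a j-tuple of
zeros of a in U independent modulo T. The induction adjoins the first vector of
the tuple to T. *)
Lemma vanishing_moment j (T : {vspace V0}) : (T <= U)%VS ->
    (\dim T + j <= h.+1)%N ->
  \sum_(a : 'rV[fL]_r | (T <= zeros e U a)%VS)
      \prod_(l < j) (q ^+ \dim (zeros e U a) - q ^+ (\dim T + l)) =
    q ^+ (n * (r - (\dim T + j))) *
      \prod_(l < j) (q ^+ \dim U - q ^+ (\dim T + l)).
Proof.
elim: j T => [|j IHj] T sTU le_Th.
  rewrite big_ord0 mulr1 addn0 -natrX -card_vanishing //; last by lia.
  rewrite -sum1_card natr_sum; apply: eq_big => [a|a _]; last by rewrite big_ord0.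
  by rewrite inE.
set d := \dim T in le_Th *.
have card_diff (W : {vspace V0}) : (T <= W)%VS ->
    q ^+ \dim W - q ^+ d = \sum_(u : finvect_type V0 | (u \in W) && (u \notin T)) 1.
  move=> sTW; rewrite -!natrX -!card_subspace sumr_const.
  rewrite -natrB ?subset_leq_card //; last first.
    by apply/subsetP => u; rewrite !inE => /(subvP sTW).
  congr _%:R; rewrite -cardsDS ?subset_leq_card //; last first.
    by apply/subsetP => u; rewrite !inE => /(subvP sTW).
  by apply: eq_card => u; rewrite !inE andbC.
under eq_bigr => a sTa do
  rewrite big_ord_recl addn0 (card_diff _ sTa) mulr_suml.
rewrite (exchange_big_dep
  (fun u : finvect_type V0 => (u \in U) && (u \notin T))) /=; last first.
  by move=> a u _; rewrite mem_zeros => /andP[/andP[-> _] ->].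
rewrite big_ord_recl addn0 (card_diff _ sTU) mulrCA mulr_suml; apply: eq_bigr => u.
case/andP => Uu nTu; rewrite mul1r.
have dimT' : \dim (T + <[u : V0]>) = d.+1 by apply: dimv_add_vline.
have sT'U : (T + <[u : V0]> <= U)%VS by rewrite subv_add sTU -memvE.
have := IHj _ sT'U; rewrite dimT' addSnnS => /(_ le_Th).
under [X in _ -> _ = _ * X]eq_bigr do rewrite lift0 addnS -addSn.
move=> <-; apply: eq_big => [a|a _].
  by rewrite subv_add -memvE nTu andbT.
by rewrite mul1r; apply: eq_bigr => l _; rewrite /bump leq0n add1n addnS -addSn.
Qed.

End Moments.

(** * Cokernels for scattered subspaces of maximum rank *)

Section MaximumScattered.

Variables (F : finFieldType) (L : fieldExtType F) (V : vectType L).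
Local Notation V0 := (baseVect V).
Local Notation fL := (finvect_type L).
Local Notation q := (#|F|%:R : rat).
Local Notation n := (\dim {:L}).
Local Notation r := (\dim {:V}).

Variables (h : nat) (U : {vspace V0}).
Hypotheses (lt_hr : (h < r)%N) (scatU : h_scattered h U).
Local Notation k := (\dim U).
Hypothesis max_rank : (k * h.+1 = r * n)%N.

Lemma card_field_gt1 : 1 < q.
Proof. by rewrite ltr1n finNzRing_gt1. Qed.

(** As U spans V, its rank k is at least r. *)
Lemma scattered_degree_gt : (h < n)%N.
Proof.
have le_rk : (r <= k)%N by have [<- _] := scatU; apply: dim_spanL_leq.
by rewrite -(@leq_pmul2l r) -?max_rank ?leq_mul2r ?le_rk ?orbT //; lia.
Qed.

Lemma scattered_rank_geq : (n <= k)%N.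
Proof. by rewrite -(leq_pmul2r (ltn0Sn h)) max_rank mulnC leq_mul2r lt_hr orbT. Qed.

Variables (e : r.-tuple V) (basis_e : basis_of fullv e).

(** The dimension over F of the cokernel of the map from U to L given by a. *)
Definition coker_dim (a : 'rV[L]_r) : nat := (\dim (zeros e U a) + n - k)%N.

Lemma coker_dim0 : coker_dim 0 = n.
Proof. by rewrite /coker_dim zeros0 addKn. Qed.

Lemma coker_moment j : (j <= h.+1)%N ->
  \sum_(a : 'rV[fL]_r) qfall q (q ^+ coker_dim a) j =
    qfall q (q ^+ n) j * q ^+ (k * (h.+1 - j)).
Proof.
move=> le_jh; have X0 := qX_neq0 card_field_gt1.
have mom i : (i <= h.+1)%N ->
    \sum_(a : 'rV[fL]_r) qfall q (q ^+ \dim (zeros e U a)) i =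
      q ^+ (n * r) * qfall q (q ^+ k) i / (q ^+ n) ^+ i.
  move=> le_ih; have := vanishing_moment basis_e lt_hr scatU (sub0v U) (j := i).
  rewrite dimv0 !add0n => /(_ le_ih).
  under eq_bigl do rewrite sub0v.
  move=> ->; rewrite mulrAC; congr (_ * _); apply: (canRL (mulfK _)).
    by rewrite -exprM X0.
  by rewrite -exprM -exprD -mulnDr subnK // (leq_trans le_ih).
(* The moments of the cokernel alone are the mixed moments with i = 0. *)
have := dual_moments (X0 k) (X0 n) mom => /(_ j 0 le_jh).
rewrite mul0n !expr0 qfall0 !mulr1 mul1r => dual.
transitivity (q ^+ (n * r) * qfall q (q ^+ n) j / (q ^+ k) ^+ j).
  rewrite -dual; apply: eq_bigr => a _; rewrite qfall0 mul1r; congr qfall.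
  by apply: (canRL (mulfK _)) => //; rewrite -!exprD subnK // codim_zeros_leq.
rewrite mulrAC mulrC; congr (_ * _); apply: (canLR (mulfK _)).
  by rewrite -exprM X0.
by rewrite -exprM -exprD -mulnDr subnK // max_rank mulnC.
Qed.

Lemma coker_moment_neq0 j : (j <= h.+1)%N ->
  \sum_(a : 'rV[fL]_r | a != 0) qfall q (q ^+ coker_dim a) j =
    qfall q (q ^+ n) j * (q ^+ (k * (h.+1 - j)) - 1).
Proof.
move=> le_jh; have := coker_moment le_jh.
rewrite (bigD1 (0 : 'rV[fL]_r)) //= coker_dim0 mulrBr mulr1 => <-.
by rewrite addrC addrK.
Qed.

(** The moment of order h + 1 over the nonzero functionals is 0, and its terms
are nonnegative, hence all 0. *)
Lemma coker_dim_leq (a : 'rV[L]_r) : a != 0 -> (coker_dim a <= h)%N.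
Proof.
move=> a0; rewrite leqNgt; apply/negP => lt_h.
have q1 := card_field_gt1.
have := coker_moment_neq0 (leqnn h.+1).
rewrite subnn muln0 expr0 subrr mulr0 => /eqP.
rewrite psumr_eq0 => [/allP/(_ (a : 'rV[fL]_r))|b _]; last exact: qfall_ge0.
rewrite mem_index_enum a0 => /(_ isT) /=.
by rewrite gt_eqF // qfall_gt0.
Qed.

Lemma card_coker_dim i : (i <= h)%N ->
  #|[set a : 'rV[fL]_r | a != 0 & coker_dim a == i]|%:R =
    (q ^+ n - 1) * tcoef #|F| r n h i.
Proof.
move=> le_ih; have dvd_rn : (h.+1 %| r * n)%N by rewrite -max_rank dvdn_mull.
rewrite tcoefE ?scattered_degree_gt ?finNzRing_gt1 //.
rewrite -max_rank mulnK //.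
pose B j := qfall q (q ^+ n) j * (q ^+ (k * (h.+1 - j)) - 1).
apply: (count_from_moments card_field_gt1 (B := B) _ _ le_ih) => [a|j le_jh].
  exact: coker_dim_leq.
by apply: coker_moment_neq0; apply: leqW.
Qed.

End MaximumScattered.

(** * Weights of the code *)

Section Theta.

Variable q : nat.
Lemma code_weightE k n i : (n <= k + i)%N ->
  code_weight q k n i = (theta q (k%:Z - 1) - theta q ((k + i - n)%:Z - 1))%N.
Proof. by move=> le_n; congr (_ - theta _ _)%N; lia. Qed.

Hypothesis q_gt1 : (1 < q)%N.

Lemma theta_mul m : (theta q (m%:Z - 1) * (q - 1) = q ^ m - 1)%N.
Proof.
rewrite /theta subrK absz_nat divnK // !subn1.
by have := dvdn_pred_predX q m.
Qed.

Lemma theta_lt m m' : (m < m')%N -> (theta q (m%:Z - 1) < theta q (m'%:Z - 1))%N.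
Proof.
move=> lt_m; rewrite -(@ltn_pmul2r (q - 1)) ?subn_gt0 // !theta_mul.
by rewrite ltn_sub2r ?ltn_exp2l // -{1}(expn0 q) ltn_exp2l //; lia.
Qed.

Lemma code_weight_lt k n i j : (n <= k)%N -> (i < j <= n)%N ->
  (code_weight q k n j < code_weight q k n i)%N.
Proof.
move=> le_nk /andP[lt_ij le_jn]; rewrite !code_weightE; try lia.
apply: ltn_sub2l; last by apply: theta_lt; lia.
by apply: theta_lt; lia.
Qed.

End Theta.

Section LinearSetCode.

Variables (F : finFieldType) (L : fieldExtType F) (V : vectType L).
Local Notation V0 := (baseVect V).
Local Notation fL := (finvect_type L).
Local Notation q := #|F|.
Local Notation n := (\dim {:L}).
Local Notation r := (\dim {:V}).

Lemma card_subspace_neq0 (W : {vspace V0}) :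
  #|[set u : finvect_type V0 | ((u : V0) \in W) && (u != 0)]| = (q ^ \dim W - 1)%N.
Proof.
rewrite -card_subspace [in RHS](cardsD1 (0 : finvect_type V0)).
by rewrite inE mem0v add1n subn1; apply: eq_card => u; rewrite !inE andbC.
Qed.

Variables (e : r.-tuple V) (basis_e : basis_of fullv e).
Variables (h : nat) (U : {vspace V0}).
Hypotheses (h_gt0 : (0 < h)%N) (lt_hr : (h < r)%N) (scatU : h_scattered h U).
Local Notation k := (\dim U).
Variables (N : nat) (p : N.-tuple V).
Hypothesis points_p : point_listing (linear_set U) p.

Definition codeword (a : 'rV[L]_r) : 'rV[L]_N := a *m generator_mx e p.

Lemma codewordE a j : codeword a ord0 j = functional e a (tnth p j).
Proof. by rewrite mxE; apply: eq_bigr => i _; rewrite mxE. Qed.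

Lemma point_inP (u : V) : (u : V0) \in U -> u != 0 ->
  exists j, <[u]>%VS = <[tnth p j]>%VS.
Proof. by move=> Uu u0; apply/points_p.2; exists u. Qed.

(** A scattered U meets the line of V that represents a point of the linear set
in a one-dimensional F-subspace. *)
Lemma card_point_vectors j :
  #|[set u : finvect_type V0 | [&& (u : V0) \in U, u != 0
      & <[u : V]>%VS == <[tnth p j]>%VS]]| = (q - 1)%N.
Proof.
have [u0 [Uu0 u0_neq0 def_pj]] : linear_set U <[tnth p j]>%VS.
  by apply/points_p.2; exists j.
pose P := (U :&: baseSubspace <[tnth p j]>)%VS.
have dimP : \dim P = 1%N.
  apply/eqP; rewrite eqn_leq; apply/andP; split.
    have dim_pj : \dim <[tnth p j]> = 1%N by rewrite def_pj dim_vline u0_neq0.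
    have := h_scattered_cap (H := <[tnth p j]>%VS) lt_hr scatU.
    by rewrite dim_pj; apply.
  rewrite lt0n dimv_eq0; apply: contraNneq u0_neq0 => P0.
  have: (u0 : V0) \in P by rewrite memv_cap Uu0 mem_baseSubspace def_pj memv_line.
  by rewrite P0 memv0.
transitivity (q ^ \dim P - 1)%N; last by rewrite dimP expn1.
rewrite -card_subspace_neq0; apply: eq_card => u.
rewrite !inE memv_cap mem_baseSubspace -andbA; congr andb.
have [-> | u_neq0] := eqVneq u 0; rewrite ?andbF ?andbT //=.
rewrite eqEdim -memvE !dim_vline u_neq0 def_pj.
by rewrite leq_b1 andbT.
Qed.

(** Each nonzero u in U on which a vanishes lies on exactly one point, and a
vanishes on that point. *)
Lemma card_zero_positions a :
  (#|[set j | functional e a (tnth p j) == 0%R]| * (q - 1) =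
    q ^ \dim (zeros e U a) - 1)%N.
Proof.
rewrite -card_subspace_neq0 -sum_nat_const -[RHS]sum1_card.
under eq_bigr => j _ do rewrite -(card_point_vectors j) -sum1_card.
rewrite (exchange_big_dep
  (fun u : finvect_type V0 => ((u : V0) \in zeros e U a) && (u != 0))) /=.
  apply: eq_big => [u|u]; first by rewrite inE.
  rewrite mem_zeros => /andP[/andP[Uu /eqP au0] u0].
  have [j0 def_j0] := point_inP Uu u0; have [p_inj _] := points_p.
  rewrite (big_pred1 j0) // => j; rewrite !inE Uu u0 def_j0 /=.
  rewrite (inj_eq p_inj) [RHS]eq_sym andbC; have [<- /=|//] := eqVneq j0 j.
  have /vlineP[c ->]: tnth p j0 \in <[u : V]>%VS by rewrite def_j0 memv_line.
  by rewrite functionalZ au0 mulr0 eqxx.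
move=> j u; rewrite !inE mem_zeros => /eqP aj0 /and3P[Uu u0 /eqP def_u].
rewrite Uu u0 andbT /=; have /vlineP[c ->]: (u : V) \in <[tnth p j]>%VS.
  by rewrite -def_u memv_line.
by rewrite functionalZ aj0 mulr0.
Qed.

Hypothesis max_rank : (k * h.+1 = r * n)%N.
Local Notation w := (code_weight q k n).
Local Notation y := (coker_dim U e).
Local Notation C := (generated_code (generator_mx e p)).

Lemma card_base_gt1 : (1 < q)%N. Proof. exact: finNzRing_gt1. Qed.

Lemma card_zero_positionsE a :
  #|[set j | functional e a (tnth p j) == 0]| = theta q ((\dim (zeros e U a))%:Z - 1).
Proof.
have q1 := card_base_gt1; apply/eqP.
by rewrite -(@eqn_pmul2r (q - 1)) ?subn_gt0 // card_zero_positions theta_mul.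
Qed.

Lemma code_lengthE : N = theta q (k%:Z - 1).
Proof.
rewrite -{1}(zeros0 e U) -card_zero_positionsE -[LHS]card_ord -cardsT.
apply: eq_card => j.
by rewrite !inE /functional big1 ?eqxx // => i _; rewrite mxE mul0r.
Qed.

Lemma hweight_codeword a : hweight (codeword a) = w (y a).
Proof.
have le_nk := scattered_rank_geq lt_hr max_rank.
have le_k : (k <= \dim (zeros e U a) + n)%N := codim_zeros_leq e U a.
rewrite code_weightE /coker_dim; last by lia.
have -> : (k + (\dim (zeros e U a) + n - k) - n = \dim (zeros e U a))%N by lia.
rewrite -card_zero_positionsE -code_lengthE -[X in (X - _)%N]card_ord -cardsT.
rewrite -cardsDS ?subsetT //.
by apply: eq_card => j; rewrite !inE codewordE andbT.
Qed.

Lemma weight_lt i j : (i < j <= h)%N -> (w j < w i)%N.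
Proof.
have lt_hn := scattered_degree_gt lt_hr scatU max_rank.
move=> lt_ij; apply: code_weight_lt; [exact: card_base_gt1 | | lia].
exact: scattered_rank_geq lt_hr max_rank.
Qed.

Lemma weight_gt0 i : (i <= h)%N -> (0 < w i)%N.
Proof.
have lt_hn := scattered_degree_gt lt_hr scatU max_rank.
have lt_nk := scattered_rank_geq lt_hr max_rank => le_ih.
by apply: leq_ltn_trans (leq0n _) (code_weight_lt card_base_gt1 lt_nk (j := n) _); lia.
Qed.

Lemma weight_inj : {in [pred i | i <= h]%N &, injective w}.
Proof.
move=> i j; rewrite !inE => le_ih le_jh eq_w.
case: (ltngtP i j) => // lt_.
  by have := @weight_lt i j; rewrite lt_ le_jh eq_w ltnn => /(_ isT).
by have := @weight_lt j i; rewrite lt_ le_ih eq_w ltnn => /(_ isT).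
Qed.

(** A nonzero functional has cokernel dimension at most h, so its codeword has
one of the weights w_0, ..., w_h, which are all positive. *)
Lemma codeword_inj : injective codeword.
Proof.
move=> a b /eqP; rewrite -subr_eq0 -mulmxBl => /eqP ab0; apply/eqP.
rewrite -subr_eq0; apply/negPn/negP.
move/(coker_dim_leq lt_hr scatU max_rank basis_e)/weight_gt0.
rewrite -hweight_codeword /codeword ab0 /hweight.
by rewrite eq_card0 // => j; rewrite !inE mxE eqxx.
Qed.

Lemma codeP c : reflect (exists a, c = codeword a) (c \in C).
Proof.
apply: (iffP idP) => [|[a ->]].
  suff sub : (C <= limg (linfun (mulmxr (generator_mx e p) : 'rV[L]_r -> 'rV[L]_N)))%VS.
    by move/(subvP sub)/memv_imgP => [a _ ->]; exists a; rewrite lfunE.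
  apply/span_subvP => _ /imageP[i _ ->]; apply/memv_imgP.
  by exists (delta_mx 0 i); rewrite ?memvf // lfunE /= -rowE.
rewrite /codeword mulmx_sum_row; apply: memv_suml => i _.
by apply/memvZ/memv_span/image_f.
Qed.

Lemma dim_code : \dim C = r.
Proof.
pose f : 'Hom('rV[L]_r, 'rV[L]_N) := linfun (mulmxr (generator_mx e p)).
have -> : C = limg f.
  apply/vspaceP => c; apply/codeP/memv_imgP => [[a ->]|[a _ ->]].
    by exists a; rewrite ?memvf // lfunE.
  by exists a; rewrite lfunE.
rewrite limg_dim_eq; first by rewrite [LHS]dimvf dim_matrix; apply: mul1n.
rewrite capfv; apply/eqP/lker0P => a b; rewrite !lfunE; apply: codeword_inj.
Qed.

Lemma codewordsE : codewords C = [set (codeword a : 'rV[fL]_N) | a : 'rV[fL]_r].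
Proof.
apply/setP => c; rewrite inE.
by apply/codeP/imsetP => [[a ->]|[a _ ->]]; exists a.
Qed.

Lemma weight_attained i : (i <= h)%N -> exists2 a : 'rV[fL]_r, a != 0 & y a = i.
Proof.
move=> le_ih; have dvd_rn : (h.+1 %| r * n)%N by rewrite -max_rank dvdn_mull.
have lt_hn := scattered_degree_gt lt_hr scatU max_rank.
have : (0 < #|[set a : 'rV[fL]_r | a != 0%R & y a == i]|)%N.
  rewrite -(ltr_nat rat) (card_coker_dim lt_hr scatU max_rank basis_e le_ih).
  rewrite mulr_gt0 ?tcoef_gt0 ?card_base_gt1 // subr_gt0 exprn_egt1 ?ltr1n ?card_base_gt1 //.
  by lia.
by case/card_gt0P => a; rewrite inE => /andP[a0 /eqP ya]; exists a.
Qed.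

Lemma min_distance_code : min_distance C (w h).
Proof.
split.
  have [a a0 ya] := weight_attained (leqnn h).
  exists (codeword a), (codeword 0).
  split; [by apply/codeP; exists a | by apply/codeP; exists 0 | | ].
    by rewrite (inj_eq codeword_inj).
  by rewrite /codeword mul0mx subr0 hweight_codeword ya.
move=> _ _ /codeP[a ->] /codeP[b ->]; rewrite (inj_eq codeword_inj) => ne_ab.
rewrite -mulmxBl hweight_codeword; rewrite -subr_eq0 in ne_ab.
have := coker_dim_leq lt_hr scatU max_rank basis_e ne_ab.
by rewrite leq_eqVlt => /predU1P[-> //|lt_yh]; rewrite ltnW // weight_lt // lt_yh leqnn.
Qed.

Lemma mem_weights m : reflect (exists2 i, (i <= h)%N & m = w i) (m \in weights C).
Proof.
rewrite mem_undup; apply: (iffP imageP) => [[c]|[i le_ih ->]].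
  rewrite !inE => /andP[c0 /codeP[a def_c]] ->; rewrite def_c hweight_codeword.
  exists (y a) => //; apply: (coker_dim_leq lt_hr scatU max_rank basis_e).
  by apply: contraNneq c0 => a0; rewrite def_c a0 /codeword mul0mx.
have [a a0 <-] := weight_attained le_ih.
exists (codeword a); last by rewrite hweight_codeword.
rewrite !inE; apply/andP; split; last by apply/codeP; exists a.
by rewrite -(mul0mx _ (generator_mx e p)) (inj_eq codeword_inj).
Qed.

Lemma weights_code : size (weights C) = h.+1 /\ weights C =i [seq w i | i <- iota 0 h.+1].
Proof.
have eqw : weights C =i [seq w i | i <- iota 0 h.+1].
  move=> m; apply/mem_weights/mapP => [[i le_ih ->]|[i]].
    by exists i; rewrite // mem_iota.
  by rewrite mem_iota add0n ltnS => /andP[_ le_ih] ->; exists i.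
split=> //; rewrite (perm_size (uniq_perm (undup_uniq _) _ eqw)) ?size_map ?size_iota //.
rewrite map_inj_in_uniq ?iota_uniq // => i j.
rewrite !mem_iota !add0n !ltnS => /andP[_ le_i] /andP[_ le_j].
exact: weight_inj.
Qed.

Lemma weight_distr_code i : (i <= h)%N ->
  (weight_distr C (w i))%:R = (q%:R ^+ n - 1) * tcoef q r n h i :> rat.
Proof.
move=> le_ih; rewrite -(card_coker_dim lt_hr scatU max_rank basis_e le_ih).
congr _%:R; rewrite -(@card_imset 'rV[fL]_r 'rV[fL]_N _ _ codeword_inj).
apply: eq_card => c.
rewrite inE codewordsE; apply/andP/imsetP => [[]|[a]].
  case/imsetP => a _ ->; rewrite hweight_codeword => /eqP w_eq.
  exists a => //; rewrite inE; have a0 : a != 0.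
    apply: contraTneq (weight_gt0 le_ih) => a0; rewrite -w_eq -hweight_codeword a0.
    rewrite /codeword mul0mx /hweight eq_card0 // => j.
    by rewrite !inE mxE eqxx.
  have le_yh := coker_dim_leq lt_hr scatU max_rank basis_e a0.
  by rewrite a0; apply/eqP/weight_inj; rewrite ?inE.
rewrite inE => /andP[_ /eqP ya] ->; split; first exact: imset_f.
by rewrite hweight_codeword ya.
Qed.

Lemma weight_distr0 : weight_distr C 0 = 1%N.
Proof.
rewrite -(cards1 (0 : 'rV[fL]_N)); apply: eq_card => c; rewrite !inE.
apply/andP/eqP => [[/codeP[a ->] /eqP wa]|->]; last first.
  split; first exact: mem0v.
  by rewrite /hweight eq_card0 // => j; rewrite !inE mxE eqxx.
have [->|a0] := eqVneq a 0; first by rewrite /codeword mul0mx.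
have := coker_dim_leq lt_hr scatU max_rank basis_e a0.
by move=> /weight_gt0; rewrite -hweight_codeword wa.
Qed.

Lemma weight_distr_other m : m != 0 -> m \notin weights C -> weight_distr C m = 0%N.
Proof.
move=> m0 nCm; apply: eq_card0 => c; rewrite !inE; apply: contraNF nCm.
case/andP => Cc /eqP wc; rewrite mem_undup; apply/imageP; exists c => //.
rewrite !inE Cc andbT; apply: contraNneq m0 => c0.
by rewrite -wc c0 /hweight eq_card0 // => j; rewrite !inE mxE eqxx.
Qed.

Lemma weight_enumerator_code : weight_enumerator C
        = 1 + \sum_(i < h.+1) (weight_distr C (w i))%:R *: 'X^(w i).
Proof.
have le_wN i : (i <= h)%N -> (w i <= N)%N.
  move=> le_ih; have [a _ <-] := weight_attained le_ih.
  by rewrite -hweight_codeword -[leqRHS]card_ord max_card.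
apply/polyP => m; rewrite coefD coef1 !coef_sum.
under eq_bigr do rewrite coefZ coefXn.
under [in RHS]eq_bigr do rewrite coefZ coefXn.
have -> : \sum_(i < N.+1) (weight_distr C i)%:R * (m == i)%:R =
   (if (m < N.+1)%N then (weight_distr C m)%:R else 0) :> int.
  case: ltnP => [lt_mN | le_Nm].
    rewrite (bigD1 (Ordinal lt_mN)) //= eqxx mulr1 big1 ?addr0 // => i.
    by rewrite -val_eqE /= eq_sym => /negPf ->; rewrite mulr0.
  rewrite big1 // => i _; rewrite gtn_eqF ?mulr0 //.
  exact: leq_trans (ltn_ord i) _.
have [-> | m0] := eqVneq m 0.
  rewrite weight_distr0 /= big1 ?addr0 // => i _.
  by rewrite ltn_eqF ?mulr0 // weight_gt0 // -ltnS.
rewrite add0r; have [/mem_weights[i le_ih ->] | nCm] := boolP (m \in weights C).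
  rewrite ltnS le_wN // (bigD1 (Ordinal (le_ih : (i < h.+1)%N))) //= eqxx mulr1.
  rewrite big1 ?addr0 // => j ne_ji; case: eqP => [w_eq|]; last by rewrite mulr0.
  case/eqP: ne_ji; apply/val_inj/weight_inj; rewrite ?inE //=.
  by rewrite -ltnS.
rewrite weight_distr_other // if_same big1 // => i _.
case: eqP => [m_eq|]; last by rewrite mulr0.
by case/mem_weights: nCm; exists i; rewrite // -ltnS.
Qed.

End LinearSetCode.

Theorem theorem7p3 (q r n h k N : nat)
    (F : finFieldType) (L : fieldExtType F) (V : vectType L)
    (hq : #|F| = q) (hn : \dim {:L} = n) (hr : \dim {:V} = r)
    (h_gt0 : (0 < h)%N) (h_lt_r : (h < r)%N)
    (hdvd : (h.+1 %| r * n)%N) (hk : k = ((r * n) %/ h.+1)%N)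
    (U : {vspace baseVect V}) (rankU : \dim U = k) (scatU : h_scattered h U)
    (e : r.-tuple V) (basis_e : basis_of fullv e)
    (p : N.-tuple V) (points_p : point_listing (linear_set U) p) :
  let C := generated_code (generator_mx e p) in
  let w := code_weight q k n in
  [/\ N = theta q (k%:Z - 1) /\ \dim C = r,
      min_distance C
        (theta q (k%:Z - 1) - theta q (k%:Z - n%:Z + h%:Z - 1))%N,
      size (weights C) = h.+1
        /\ weights C =i [seq w i | i <- iota 0 h.+1],
      weight_enumerator C
        = 1 + \sum_(i < h.+1) (weight_distr C (w i))%:R *: 'X^(w i)
    & forall i : nat, (i <= h)%N ->
        (weight_distr C (w i))%:R = (q%:R ^+ n - 1) * tcoef q r n h i :> rat].
Proof.
subst q n r; rewrite -{}rankU in hk *.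
move=> C w; rewrite {}/C {}/w.
have max_rank : (\dim U * h.+1 = \dim {:V} * \dim {:L})%N by rewrite hk divnK.
split.
- split; first exact: (code_lengthE e h_gt0 h_lt_r scatU points_p).
  exact: (dim_code basis_e h_gt0 h_lt_r scatU points_p max_rank).
- exact: (min_distance_code basis_e h_gt0 h_lt_r scatU points_p max_rank).
- exact: (weights_code basis_e h_gt0 h_lt_r scatU points_p max_rank).
- exact: (weight_enumerator_code basis_e h_gt0 h_lt_r scatU points_p max_rank).
exact: (weight_distr_code basis_e h_gt0 h_lt_r scatU points_p max_rank).
Qed.
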